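(* Let $G$ be a finite group. Then $\mathrm{ZL}^1(G)$ has a unique diagonal, and \[ \mathrm{am}(\mathrm{ZL}^1(G))=\frac{1}{|G|^2}\sum_{C,C'\in\mathrm{Conj}(G)}\Big|\sum_{\pi\in\widehat G}d_\pi^2\,\overline{\chi_\pi(C)}\,\chi_\pi(C')\Big|\,|C|\,|C'|. \]
   Context: $G$ is given normalised Haar measure $\int_G f=\frac{1}{|G|}\sum_{s\in G}f(s)$; $\mathrm{L}^1(G)$ is the corresponding convolution algebra with norm $\|f\|_1=\frac1{|G|}\sum|f(s)|$ and $\mathrm{ZL}^1(G)$ its centre. $\mathrm{Conj}(G)$ is the set of conjugacy classes; $\widehat G$ the irreducible representations, $d_\pi$ the dimension, $\chi_\pi$ the character, and $\chi_\pi(C)$ its value on the class $C$. A diagonal for a unital Banach algebra $\mathfrak{A}$ is an element $\mu\in\mathfrak{A}\hat\otimes\mathfrak{A}$ with $a\cdot\mu=\mu\cdot a$ for all $a$ and $m(\mu)=1$, where $m$ is multiplication, $a\cdot(b\otimes c)=ab\otimes c$, $(b\otimes c)\cdot a=b\otimes ca$. The amenability constant $\mathrm{am}(\mathfrak{A})$ is the infimum of $\sup_\alpha\|\mu_\alpha\|$ over bounded approximate diagonals $(\mu_\alpha)$ (bounded nets in $\mathfrak{A}\hat\otimes\mathfrak{A}$ with $m(\mu_\alpha)a\to a$, $a\,m(\mu_\alpha)\to a$, $a\cdot\mu_\alpha-\mu_\alpha\cdot a\to0$). *)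

(* Defs.v *)
From HB Require Import structures.
From mathcomp Require Import all_boot all_order all_algebra all_fingroup all_solvable.
From mathcomp Require Import all_field all_character.
From mathcomp Require Import complex.
From mathcomp Require Import boolp classical_sets reals.

Set Implicit Arguments.
Unset Strict Implicit.
Unset Printing Implicit Defensive.

Import Order.TTheory GRing.Theory Num.Theory.
Local Open Scope ring_scope.

Section ZL1.
Variables (R : realType) (gT : finGroupType).
Local Notation C := R[i].

Definition cmod (z : C) : R := complex.Re `|z|.

Definition ordG : C := (#|gT|%:R : C).

(* L^1(G) with normalised Haar measure: functions G -> C *)
Definition L1 := {ffun gT -> C}.

Definition conv (f g : L1) : L1 :=
  [ffun s => ordG^-1 * \sum_(t : gT) f t * g (t^-1 * s)%g].

Definition norm1 (f : L1) : R := (#|gT|%:R)^-1 * \sum_(s : gT) cmod (f s).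

Definition inZL1 (f : L1) : Prop := forall g : L1, conv f g = conv g f.

Definition oneL1 : L1 := [ffun s => if s == 1%g then ordG else 0].

(* The algebraic tensor product of subspaces of C^G, realised (as usual for
   finite-dimensional function spaces) inside the functions on G x G. *)
Definition Tens := {ffun gT * gT -> C}.
Definition tens (a b : L1) : Tens := [ffun p => a p.1 * b p.2].

Definition is_rep (s : seq (L1 * L1)) (u : Tens) : Prop :=
  (forall p, p \in s -> inZL1 p.1 /\ inZL1 p.2) /\
  u = \sum_(p <- s) tens p.1 p.2.

Definition inZZ (u : Tens) : Prop := exists s, is_rep s u.

Definition pnorm (u : Tens) : R :=
  inf [set r : R | exists s, is_rep s u /\
                   r = \sum_(p <- s) norm1 p.1 * norm1 p.2].

(* module actions: a.(b (x) c) = ab (x) c,  (b (x) c).a = b (x) ca,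
   extended linearly *)
Definition lact (a : L1) (u : Tens) : Tens :=
  [ffun p => ordG^-1 * \sum_(r : gT) a r * u ((r^-1 * p.1)%g, p.2)].
Definition ract (u : Tens) (a : L1) : Tens :=
  [ffun p => ordG^-1 * \sum_(r : gT) u (p.1, r) * a (r^-1 * p.2)%g].

(* multiplication map m : b (x) c |-> b * c, extended linearly *)
Definition mult (u : Tens) : L1 :=
  [ffun s => ordG^-1 * \sum_(t : gT) u (t, (t^-1 * s)%g)].

Definition is_diagonal (mu : Tens) : Prop :=
  inZZ mu /\ (forall a, inZL1 a -> lact a mu = ract mu a) /\ mult mu = oneL1.

Definition directed (I : Type) (le : I -> I -> Prop) : Prop :=
  (exists i : I, True) /\ (forall i, le i i) /\
  (forall i j k, le i j -> le j k -> le i k) /\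
  (forall i j, exists k, le i k /\ le j k).

Definition net_to0 (I : Type) (le : I -> I -> Prop) (x : I -> R) : Prop :=
  forall e : R, 0 < e -> exists i0, forall i, le i0 i -> x i < e.

Definition bdd_approx_diag (I : Type) (le : I -> I -> Prop) (mu : I -> Tens)
  : Prop :=
  directed le /\ (forall i, inZZ (mu i)) /\
  (exists M : R, forall i, pnorm (mu i) <= M) /\
  (forall a, inZL1 a ->
     net_to0 le (fun i => norm1 (conv (mult (mu i)) a - a)) /\
     net_to0 le (fun i => norm1 (conv a (mult (mu i)) - a)) /\
     net_to0 le (fun i => pnorm (lact a (mu i) - ract (mu i) a))).

Definition amZL1 : R :=
  inf [set M : R | exists (I : Type) (le : I -> I -> Prop) (mu : I -> Tens),
         bdd_approx_diag le mu /\ M = sup (range (fun i => pnorm (mu i)))].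

Definition chi_val (sG : irrType C [set: gT]%G) (i : sG) (x : gT) : C :=
  \tr (irr_repr i x).

End ZL1.

(* Main.v *)
(* The algebra [ZL1 (x) ZL1] consists of the functions on [gT * gT] that are
   class functions of each variable, and averaging the delta functions over
   conjugation shows that its projective norm is the normalised l1 norm.
   If [mu = \sum_k a_k (x) b_k] is a diagonal and [nu] is any tensor,
   expanding the product [mu nu] in two ways gives
     [mu . m(nu) - nu = \sum_k (a_k . nu - nu . a_k) . b_k].
   For a diagonal [nu] this reads [mu = nu]; along a bounded approximate
   diagonal both [mu . m(nu) - mu] and the right-hand side tend to 0, so that
   the norm of [mu] bounds the amenability constant from below, and the
   constant net [mu] attains it.  By Schur's lemma the diagonal is
   [\sum_p e_p (x) e_p], where [e_p = d_p chi_p] are the central idempotents;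
   replacing [s] by [s^-1] turns [chi_p s] into its conjugate. *)

Require Import Defs.
From HB Require Import structures.
From mathcomp Require Import all_boot all_order all_algebra all_fingroup all_solvable.
From mathcomp Require Import all_field all_character.
From mathcomp Require Import complex.
From mathcomp Require Import boolp classical_sets reals.
Import Order.TTheory GRing.Theory Num.Theory.
Local Open Scope ring_scope.

Set Implicit Arguments.
Unset Strict Implicit.

Local Notation ract := Defs.ract.
Local Notation norm1 := Defs.norm1.

(** * The real-valued modulus on [R[i]] *)

Section ComplexModulus.
Variable R : realType.
Implicit Types z w : R[i].

(** The norm of [R[i]] takes its values in [R[i]]; this identity transports its properties to
    [cmod], since the embedding of [R] is injective and reflects the order. *)
Lemma cmodE z : (cmod z)%:C%C = `|z|.
Proof. by rewrite /cmod RRe_real // normr_real. Qed.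

Lemma cmod0 : cmod (0 : R[i]) = 0.
Proof. by apply: complexI; rewrite cmodE normr0. Qed.

Lemma cmod_ge0 z : 0 <= cmod z.
Proof. by rewrite -ler0c cmodE. Qed.

Lemma cmodM z w : cmod (z * w) = cmod z * cmod w.
Proof. by apply: complexI; rewrite rmorphM /= !cmodE normrM. Qed.

Lemma cmodD z w : cmod (z + w) <= cmod z + cmod w.
Proof. by rewrite -lecR rmorphD /= !cmodE ler_normD. Qed.

Lemma cmodN z : cmod (- z) = cmod z.
Proof. by apply: complexI; rewrite !cmodE normrN. Qed.

Lemma cmod_natV n : cmod (n%:R^-1 : R[i]) = n%:R^-1.
Proof.
by apply: complexI; rewrite cmodE fmorphV rmorph_nat normfV ger0_norm ?ler0n.
Qed.

Lemma cmod_nat n : cmod (n%:R : R[i]) = n%:R.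
Proof. by apply: complexI; rewrite cmodE rmorph_nat ger0_norm ?ler0n. Qed.

Lemma cmod_sum (I : Type) (r : seq I) (P : pred I) (F : I -> R[i]) :
  cmod (\sum_(i <- r | P i) F i) <= \sum_(i <- r | P i) cmod (F i).
Proof.
elim/big_rec2: _ => [|i y z _ le_zy]; first by rewrite cmod0.
by apply: le_trans (cmodD _ _) _; rewrite lerD2l.
Qed.

End ComplexModulus.

Lemma sum_pair (V : nmodType) (I J : finType) (F : I * J -> V) :
  \sum_p F p = \sum_i \sum_j F (i, j).
Proof. by rewrite pair_bigA; apply: eq_bigr => -[]. Qed.

(** * The convolution algebra and its centre *)

Section Convolution.
Variables (R : realType) (gT : finGroupType).
Local Notation C := R[i].
Local Notation L1 := (L1 R gT).
Local Notation Tens := (Tens R gT).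
Local Notation oneL1 := (oneL1 R gT).
Implicit Types (f g a b c d : L1) (u v w mu nu : Tens) (x y : gT).

Lemma ordG_neq0 : ordG R gT != 0.
Proof. by rewrite pnatr_eq0 -lt0n; apply/card_gt0P; exists 1%g. Qed.

(** Commutation with the delta function at [y], evaluated at [x * y], compares [f x] with
    [f (x ^ y)]. Conversely, the substitution of [s * t^-1] for [t] swaps the two factors up to a
    conjugation by [t]. *)
Lemma inZL1P f : inZL1 f <-> forall x y, f (x ^ y)%g = f x.
Proof.
split=> [fZ x y | fJ g].
  pose dy : L1 := [ffun s => (s == y)%:R].
  have /ffunP/(_ (x * y)%g) := fZ dy.
  rewrite !ffunE => /(mulfI (invr_neq0 ordG_neq0)).
  rewrite (bigD1 x) //= big1 ?addr0; last first.
    move=> t neq_tx; rewrite ffunE.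
    rewrite (_ : (_ == y) = false) ?mulr0 //.
    apply: contraNF neq_tx => /eqP /(congr1 (mulg t)).
    by rewrite mulKVg => /mulIg ->.
  rewrite (bigD1 y) //= big1 ?addr0; last first.
    by move=> t /negPf neq_ty; rewrite ffunE neq_ty mul0r.
  by rewrite !ffunE mulKg eqxx mulr1 mul1r => ->; rewrite conjgE.
apply/ffunP=> s; rewrite !ffunE; congr (_ * _).
rewrite (reindex_inj (inj_comp (mulgI s) invg_inj)) /=.
apply: eq_bigr => t _; rewrite mulrC invMg invgK mulgKV; congr (_ * _).
by rewrite -(fJ _ t) conjgE mulgKV.
Qed.

Lemma conv_oneL1 f : conv f oneL1 = f.
Proof.
apply/ffunP=> s; rewrite ffunE (bigD1 s) //= big1 => [|t neq_ts].
  by rewrite ffunE mulVg eqxx addr0 mulrC mulfK ?ordG_neq0.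
rewrite ffunE (_ : (_ == _) = false) ?mulr0 //.
apply: contraNF neq_ts => /eqP /(congr1 (mulg t)).
by rewrite mulKVg mulg1 => ->.
Qed.

Lemma convA a b c : conv (conv a b) c = conv a (conv b c).
Proof.
apply/ffunP=> s; rewrite !ffunE; congr (_ * _).
under eq_bigr do rewrite ffunE -mulrA mulr_suml mulr_sumr.
rewrite exchange_big; apply: eq_bigr => t _ /=.
rewrite ffunE mulrCA mulr_sumr mulr_sumr.
rewrite (reindex_inj (mulgI t)); apply: eq_bigr => r _ /=.
by rewrite mulKg invMg -!mulgA -[a t * _ * _]mulrA.
Qed.

Lemma inZL1_conv a b : inZL1 a -> inZL1 b -> inZL1 (conv a b).
Proof.
by move=> aZ bZ g; rewrite convA bZ -convA aZ convA.
Qed.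

Lemma oneL1_central : inZL1 oneL1.
Proof.
apply/inZL1P => x y; rewrite !ffunE; congr (if _ then _ else _).
by rewrite -(inj_eq (conjg_inj y) x) conj1g.
Qed.

(** * Module actions and multiplication on elementary tensors *)

Lemma lact_tens a b c : lact a (tens b c) = tens (conv a b) c.
Proof.
apply/ffunP=> p; rewrite !ffunE -mulrA mulr_suml; congr (_ * _).
by apply: eq_bigr => r _; rewrite ffunE mulrA.
Qed.

Lemma ract_tens a b c : ract (tens b c) a = tens b (conv c a).
Proof.
apply/ffunP=> p; rewrite !ffunE [RHS]mulrCA; congr (_ * _); rewrite mulr_sumr.
by apply: eq_bigr => r _; rewrite ffunE mulrA.
Qed.

Lemma mult_tens a b : mult (tens a b) = conv a b.
Proof.
by apply/ffunP=> s; rewrite !ffunE; under eq_bigr do rewrite ffunE.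
Qed.

Lemma lact_is_additive a : zmod_morphism (lact a).
Proof.
move=> u v; apply/ffunP=> p; rewrite !ffunE -mulrBr -sumrB; congr (_ * _).
by apply: eq_bigr => r _; rewrite !ffunE mulrBr.
Qed.
HB.instance Definition _ a :=
  GRing.isZmodMorphism.Build Tens Tens (lact a) (lact_is_additive a).

(** The right action is additive in each argument; the flipped form carries the additivity in the
    tensor, [ract u] itself that in the algebra element. *)
Definition ract_by a u : Tens := ract u a.

Lemma ract_by_is_additive a : zmod_morphism (ract_by a).
Proof.
move=> u v; apply/ffunP=> p; rewrite !ffunE -mulrBr -sumrB; congr (_ * _).
by apply: eq_bigr => r _; rewrite !ffunE mulrBl.
Qed.
HB.instance Definition _ a :=
  GRing.isZmodMorphism.Build Tens Tens (ract_by a) (ract_by_is_additive a).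

Lemma ract_is_additive u : zmod_morphism (@Defs.ract R gT u).
Proof.
move=> a b; apply/ffunP=> p; rewrite !ffunE -mulrBr -sumrB; congr (_ * _).
by apply: eq_bigr => r _; rewrite !ffunE mulrBr.
Qed.
HB.instance Definition _ u :=
  GRing.isZmodMorphism.Build L1 Tens (ract u) (ract_is_additive u).

Lemma mult_is_additive : zmod_morphism (@mult R gT).
Proof.
move=> u v; apply/ffunP=> p; rewrite !ffunE -mulrBr -sumrB; congr (_ * _).
by apply: eq_bigr => r _; rewrite !ffunE.
Qed.
HB.instance Definition _ :=
  GRing.isZmodMorphism.Build Tens L1 (@mult R gT) mult_is_additive.

(** * Central tensors, expansion of products and uniqueness of the diagonal *)

Lemma is_rep_cat s1 s2 u1 u2 :
  is_rep s1 u1 -> is_rep s2 u2 -> is_rep (s1 ++ s2) (u1 + u2).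
Proof.
move=> [Z1 ->] [Z2 ->]; split; last by rewrite big_cat.
by move=> p; rewrite mem_cat => /orP[/Z1|/Z2].
Qed.

Lemma is_rep_map (h : L1 * L1 -> L1 * L1) s u :
    (forall p, inZL1 p.1 /\ inZL1 p.2 -> inZL1 (h p).1 /\ inZL1 (h p).2) ->
  is_rep s u ->
  is_rep (map h s) (\sum_(p <- s) tens (h p).1 (h p).2).
Proof.
move=> hZ [sZ _]; split; last by rewrite big_map.
by move=> _ /mapP[p s_p ->]; apply/hZ/sZ.
Qed.

Lemma inZZ_lact a u : inZL1 a -> inZZ u -> inZZ (lact a u).
Proof.
move=> aZ [s su]; exists (map (fun p => (conv a p.1, p.2)) s).
have -> : lact a u = \sum_(p <- s) tens (conv a p.1) p.2.
  by case: su => _ ->; rewrite raddf_sum; under eq_bigr do rewrite /= lact_tens.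
apply: (is_rep_map (h := fun p => _) _ su) => p [p1 p2].
by split=> //=; apply: inZL1_conv.
Qed.

Lemma inZZ_ract a u : inZL1 a -> inZZ u -> inZZ (ract u a).
Proof.
move=> aZ [s su]; exists (map (fun p => (p.1, conv p.2 a)) s).
have -> : ract u a = \sum_(p <- s) tens p.1 (conv p.2 a).
  case: su => _ ->; rewrite -/(ract_by _ _) raddf_sum.
  by under eq_bigr do rewrite /= /ract_by ract_tens.
apply: (is_rep_map (h := fun p => _) _ su) => p [p1 p2].
by split=> //=; apply: inZL1_conv.
Qed.

Lemma inZL1N a : inZL1 a -> inZL1 (- a).
Proof. by move=> /inZL1P aJ; apply/inZL1P => x y; rewrite !ffunE aJ. Qed.

Lemma tensNl a b : tens (- a) b = - tens a b.
Proof. by apply/ffunP=> p; rewrite !ffunE mulNr. Qed.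

Lemma inZZB u v : inZZ u -> inZZ v -> inZZ (u - v).
Proof.
move=> [s su] [s' s'v].
have s'Nv : is_rep (map (fun p => (- p.1, p.2)) s') (- v).
  have -> : - v = \sum_(p <- s') tens (- p.1) p.2.
    by case: s'v => _ ->; rewrite -sumrN; under eq_bigr do rewrite -tensNl.
  apply: (is_rep_map (h := fun p => _) _ s'v) => p [p1 p2].
  by split=> //=; apply: inZL1N.
by exists (s ++ map (fun p => (- p.1, p.2)) s'); apply: is_rep_cat.
Qed.

(* Both sides expand the product [mu nu] in the commutative algebra
   [ZL1 (x) ZL1]. *)
Lemma tens_mul_comm s s' mu nu : is_rep s mu -> is_rep s' nu ->
  \sum_(p <- s) ract (lact p.1 nu) p.2 =
  \sum_(q <- s') ract (lact q.1 mu) q.2.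
Proof.
have expand s1 s2 u2 : is_rep s2 u2 ->
    \sum_(p <- s1) ract (lact p.1 u2) p.2 =
    \sum_(p <- s1) \sum_(q <- s2) tens (conv p.1 q.1) (conv q.2 p.2).
  case=> _ ->; apply: eq_bigr => p _; rewrite raddf_sum -/(ract_by _ _) raddf_sum.
  by apply: eq_bigr => q _; rewrite /= /ract_by lact_tens ract_tens.
move=> smu s'nu; rewrite (expand _ _ _ smu) (expand _ _ _ s'nu) exchange_big /=.
apply: eq_big_seq => q /(proj1 s'nu)[q1 q2].
by apply: eq_big_seq => p /(proj1 smu)[p1 p2]; rewrite p1 q2.
Qed.

Lemma ractA s u a b : is_rep s u -> ract (ract u a) b = ract u (conv a b).
Proof.
case=> _ ->; rewrite -![ract (\sum_(_ <- _) _) _]/(ract_by _ _) !raddf_sum.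
rewrite -/(ract_by _ _) raddf_sum.
by apply: eq_bigr => p _; rewrite /= /ract_by !ract_tens convA.
Qed.

Lemma ract_oneL1 s u : is_rep s u -> ract u oneL1 = u.
Proof.
case=> _ ->; rewrite -/(ract_by _ _) raddf_sum.
by apply: eq_bigr => p _; rewrite /= /ract_by ract_tens conv_oneL1.
Qed.

(** Acting by [a_k] and then by [b_k] is acting by their convolution, and these convolutions sum to
    [mult u]. *)
Lemma ract_mult s u v : is_rep s u -> inZZ v ->
  \sum_(p <- s) ract (ract v p.1) p.2 = ract v (mult u).
Proof.
case=> _ -> [s' s'v]; rewrite !raddf_sum; apply: eq_bigr => p _.
by rewrite /= (ractA _ _ s'v) mult_tens.
Qed.

(** Re-expanded over the legs of [nu], the terms [lact p.1 nu] become actions on [mu], whose balance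
    turns left into right and yields [ract mu (mult nu)]. The subtracted terms collapse to
    [ract nu (mult mu)], which is [nu]. *)
Lemma diagonal_defect s mu nu :
    is_rep s mu -> is_diagonal mu -> inZZ nu ->
  ract mu (mult nu) - nu =
  \sum_(p <- s) ract (lact p.1 nu - ract nu p.1) p.2.
Proof.
move=> smu [muZ [mu_bal mu1]] nuZ; have [s' s'nu] := nuZ.
under [RHS]eq_bigr do rewrite -/(ract_by _ _) raddfB.
rewrite /ract_by sumrB (tens_mul_comm smu s'nu) (ract_mult smu nuZ) mu1.
rewrite (ract_oneL1 s'nu) -(ract_mult s'nu muZ); congr (_ - _).
by apply: eq_big_seq => q /(proj1 s'nu)[q1 _]; rewrite mu_bal.
Qed.

Lemma diagonal_unique mu nu : is_diagonal mu -> is_diagonal nu -> mu = nu.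
Proof.
move=> Dmu [nuZ [nu_bal nu1]]; have [[s smu] _] := Dmu.
have := diagonal_defect smu Dmu nuZ.
rewrite nu1 (ract_oneL1 smu) big_seq big1 => [/eqP|p /(proj1 smu)[p1 _]].
  by rewrite subr_eq0 => /eqP.
by rewrite nu_bal // subrr -/(ract_by _ _) raddf0.
Qed.

(** * The normalised l1 norm on pairs and the projective norm *)

Definition normT u : R := (#|gT|%:R ^+ 2)^-1 * \sum_p cmod (u p).

Lemma cardG_gt0 : 0 < #|gT|%:R :> R.
Proof. by rewrite ltr0n; apply/card_gt0P; exists 1%g. Qed.

Lemma normT_ge0 u : 0 <= normT u.
Proof.
by rewrite mulr_ge0 ?invr_ge0 ?exprn_ge0 ?ler0n ?sumr_ge0 // => p _; apply: cmod_ge0.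
Qed.

Lemma norm1_ge0 a : 0 <= norm1 a.
Proof.
by rewrite mulr_ge0 ?invr_ge0 ?ler0n ?sumr_ge0 // => p _; apply: cmod_ge0.
Qed.

Lemma normTD u v : normT (u + v) <= normT u + normT v.
Proof.
rewrite -mulrDr ler_wpM2l ?invr_ge0 ?exprn_ge0 ?ler0n // -big_split.
by apply: ler_sum => p _; rewrite ffunE cmodD.
Qed.

Lemma normTN u : normT (- u) = normT u.
Proof. by congr (_ * _); apply: eq_bigr => p _; rewrite ffunE cmodN. Qed.

Lemma normT_sum (I : Type) (r : seq I) (F : I -> Tens) :
  normT (\sum_(i <- r) F i) <= \sum_(i <- r) normT (F i).
Proof.
elim/big_rec2: _ => [|i y z _ le_zy].
  by rewrite /normT big1 ?mulr0 // => p _; rewrite ffunE cmod0.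
by apply: le_trans (normTD _ _) _; rewrite lerD2l.
Qed.

Lemma normT_tens a b : normT (tens a b) = norm1 a * norm1 b.
Proof.
rewrite /normT /norm1 mulrACA -invfM -expr2 big_distrlr pair_bigA /=.
by congr (_ * _); apply: eq_bigr => p _; rewrite ffunE cmodM.
Qed.

(** For each fixed first coordinate this is submultiplicativity of the L1 norm under convolution in
    the second one. *)
Lemma normT_ract u a : normT (ract u a) <= normT u * norm1 a.
Proof.
rewrite /normT /norm1 mulrACA -mulrA.
rewrite ler_wpM2l ?invr_ge0 ?exprn_ge0 ?ler0n //.
rewrite mulr_suml mulr_sumr.
rewrite !sum_pair.
apply: ler_sum => x _; rewrite -mulr_sumr.
apply: le_trans (_ : \sum_y #|gT|%:R^-1 *
  \sum_r cmod (u (x, r)) * cmod (a (r^-1 * y)%g) <= _).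
  apply: ler_sum => y _; rewrite ffunE cmodM cmod_natV.
  rewrite ler_wpM2l ?invr_ge0 ?ler0n //.
  by apply: le_trans (cmod_sum _ _ _) _; under eq_bigr do rewrite cmodM.
rewrite -mulr_sumr ler_wpM2l ?invr_ge0 ?ler0n // exchange_big /=.
apply: ler_sum => r _; rewrite -mulr_sumr.
by rewrite [in leRHS](reindex_inj (mulgI r^-1%g)).
Qed.

Lemma inZZ_class u : inZZ u ->
  forall x y x' y', u (x ^ x', y ^ y')%g = u (x, y).
Proof.
move=> [s [sZ ->]] x y x' y'; rewrite !sum_ffunE.
apply: eq_big_seq => p /sZ[/inZL1P p1 /inZL1P p2].
by rewrite !ffunE p1 p2.
Qed.

(** This is the indicator function of the class of [x] divided by the size of the class; averaging
    over all of [gT] avoids counting class sizes. *)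
Definition avg_delta x : L1 :=
  [ffun s => (ordG R gT)^-1 * \sum_g (x ^ g == s)%g%:R].

Lemma avg_delta_central x : inZL1 (avg_delta x).
Proof.
apply/inZL1P=> s y; rewrite !ffunE; congr (_ * _).
rewrite (reindex_inj (mulIg y)); apply: eq_bigr => g _ /=.
by rewrite conjgM (inj_eq (conjg_inj y)).
Qed.

Lemma norm1_avg_delta x : norm1 (avg_delta x) = #|gT|%:R^-1.
Proof.
rewrite -[RHS]mulr1; congr (_ * _).
have cE s : cmod (avg_delta x s) = #|gT|%:R^-1 * \sum_g (x ^ g == s)%g%:R.
  by rewrite ffunE cmodM cmod_natV -natr_sum cmod_nat natr_sum.
under eq_bigr do rewrite cE.
rewrite -mulr_sumr exchange_big /=.
under eq_bigr => g _.
  rewrite (bigD1 (x ^ g)%g) //= eqxx big1 ?addr0; last first.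
    by move=> s /negPf; rewrite eq_sym => ->.
  over.
by rewrite sumr_const mulVf // gt_eqF // cardG_gt0.
Qed.

(** For each conjugating element [g] only [x = s ^ g^-1] contributes, and there [F] takes the value
    [F s]. *)
Lemma sum_avg_delta (F : gT -> C) s : (forall x y, F (x ^ y)%g = F x) ->
  \sum_x F x * avg_delta x s = F s.
Proof.
move=> FJ; under eq_bigr do rewrite ffunE mulrCA mulr_sumr.
rewrite -mulr_sumr exchange_big /=.
under eq_bigr => g _.
  rewrite (bigD1 (s ^ g^-1)%g) //= conjgKV eqxx mulr1 FJ big1 ?addr0; last first.
    move=> x neq_x; rewrite (_ : (_ == s) = false) ?mulr0 //.
    by apply: contraNF neq_x => /eqP <-; rewrite conjgK.
  over.
by rewrite sumr_const -[F s *+ _]mulr_natl mulKf // ordG_neq0.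
Qed.

(** An optimal representation for the projective norm: all averaged deltas have the same norm, so
    its cost is exactly [normT u]. *)
Definition avg_rep u : seq (L1 * L1) :=
  [seq ([ffun s => u p * avg_delta p.1 s], avg_delta p.2)
     | p <- index_enum (gT * gT)%type].

Lemma avg_repP u : (forall x y x' y', u (x ^ x', y ^ y')%g = u (x, y)) ->
  is_rep (avg_rep u) u.
Proof.
move=> uJ; split=> [_ /mapP[p _ ->]|].
  split=> /=; last exact: avg_delta_central.
  have /inZL1P aJ := avg_delta_central p.1.
  by apply/inZL1P => x y; rewrite ffunE [RHS]ffunE aJ.
apply/ffunP=> -[s t]; rewrite big_map sum_ffunE.
under eq_bigr => p _ do rewrite ffunE /= ffunE.
rewrite sum_pair /=.
rewrite exchange_big /=.
under eq_bigr => y _.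
  rewrite -mulr_suml (sum_avg_delta (F := fun x => u (x, y))); last first.
    (* Conjugating the other coordinate by 1 extracts invariance in one variable from the joint
       invariance. *)
    by move=> x g; rewrite -[in LHS](conjg1 y) uJ.
  over.
rewrite (sum_avg_delta (F := fun y => u (s, y))) // => y g.
by rewrite -[in LHS](conjg1 s) uJ.
Qed.

Lemma avg_rep_norm u :
  \sum_(p <- avg_rep u) norm1 p.1 * norm1 p.2 = normT u.
Proof.
rewrite big_map /normT mulr_sumr; apply: eq_bigr => p _ /=.
have -> : norm1 ([ffun s => u p * avg_delta p.1 s] : L1) =
    cmod (u p) * norm1 (avg_delta p.1).
  rewrite /norm1 [RHS]mulrCA; congr (_ * _); rewrite mulr_sumr.
  by apply: eq_bigr => s _; rewrite ffunE cmodM.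
by rewrite !norm1_avg_delta -mulrA -invfM -expr2 mulrC.
Qed.

(** [normT] is multiplicative on elementary tensors, so the triangle inequality bounds every
    representation from below; [avg_rep u] attains the bound. *)
Lemma pnorm_normT u : inZZ u -> pnorm u = normT u.
Proof.
move=> uZ; rewrite /pnorm; set S := (X in inf X).
have Su : S (normT u).
  exists (avg_rep u); rewrite avg_rep_norm; split=> //.
  exact/avg_repP/inZZ_class.
have Sle : (lbound S (normT u))%classic.
  move=> _ [s [[_ ->] ->]]; apply: le_trans (normT_sum _ _) _.
  by apply: ler_sum => p _; rewrite normT_tens.
apply/eqP; rewrite eq_le ge_inf //=; last by exists (normT u).
by apply: lb_le_inf => //; exists (normT u).
Qed.

End Convolution.

(** * Real nets tending to 0 *)

Section Nets.
Variables (R : realType) (I : Type) (le : I -> I -> Prop).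
Hypothesis le_dir : directed le.

Lemma net_to0_0 : net_to0 le (fun=> 0 : R).
Proof. by move=> e e_gt0; have [[i _] _] := le_dir; exists i. Qed.

Lemma net_to0D (x y : I -> R) :
  net_to0 le x -> net_to0 le y -> net_to0 le (fun i => x i + y i).
Proof.
have [_ [_ [le_trans le_ub]]] := le_dir => x0 y0 e e_gt0.
have [i xi] := x0 _ (divr_gt0 e_gt0 (ltr0n _ 2)).
have [j yj] := y0 _ (divr_gt0 e_gt0 (ltr0n _ 2)).
have [k [le_ik le_jk]] := le_ub i j; exists k => l le_kl.
by rewrite [e]splitr ltrD ?xi ?yj //; apply: le_trans le_kl.
Qed.

Lemma net_to0M (c : R) (x : I -> R) :
  0 <= c -> net_to0 le x -> net_to0 le (fun i => x i * c).
Proof.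
(* Dividing by [c + 1] covers the case [c = 0]. *)
move=> c_ge0 x0 e e_gt0; have c1_gt0 : 0 < c + 1 by apply: ltr_wpDl.
have [i xi] := x0 _ (divr_gt0 e_gt0 c1_gt0); exists i => j /xi lt_xj.
apply: le_lt_trans (ler_wpM2r c_ge0 (ltW lt_xj)) _.
by rewrite -mulrA gtr_pMr // mulrC ltr_pdivrMr // mul1r ltrDl.
Qed.

Lemma net_to0_sum (T : eqType) (s : seq T) (x : T -> I -> R) :
    (forall t, t \in s -> net_to0 le (x t)) ->
  net_to0 le (fun i => \sum_(t <- s) x t i).
Proof.
elim: s => [_|t s IHs x0].
  by under [fun i => _]funext do rewrite big_nil; apply: net_to0_0.
under [fun i => _]funext do rewrite big_cons.
apply: net_to0D; first by apply: x0; rewrite mem_head.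
by apply: IHs => t' s_t'; apply: x0; rewrite mem_behead.
Qed.

End Nets.

(** * The amenability constant as the norm of a diagonal *)

Section AmenabilityConstant.
Variables (R : realType) (gT : finGroupType).
Implicit Types mu nu : Tens R gT.

Lemma diagonal_le_approx (I : Type) (le : I -> I -> Prop) mu
    (nu : I -> Tens R gT) (M : R) :
    is_diagonal mu -> bdd_approx_diag le nu ->
  (forall i, pnorm (nu i) <= M) -> normT mu <= M.
Proof.
move=> Dmu [dir [nuZ [_ nu_lim]]] nuM.
have [[s smu] _] := Dmu; have [sZ _] := smu.
pose one := oneL1 R gT; have oneZ : inZL1 one by apply: oneL1_central.
(* [err i] dominates the norm of [mu - nu i]: the first term controls [ract mu (mult (nu i) - one)],
   the second the defect sum. *)
pose err i := norm1 (conv (mult (nu i)) one - one) * normT mu +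
  \sum_(p <- s) pnorm (lact p.1 (nu i) - ract (nu i) p.1) * norm1 p.2.
have err0 : net_to0 le err.
  apply: net_to0D => //.
    by apply: net_to0M; [apply: normT_ge0 | case: (nu_lim _ oneZ)].
  apply: net_to0_sum => // p /sZ[p1 _].
  by apply: net_to0M; [apply: norm1_ge0 | case: (nu_lim _ p1) => _ []].
(* It suffices to bound by [M + e]; reflexivity of the order lets the threshold index itself be
   used. *)
apply/ler_addgt0Pr => e /err0[i /(_ i (proj1 (proj2 dir) i)) lt_err].
apply: le_trans (lerD (nuM i) (ltW lt_err)).
rewrite pnorm_normT // /err conv_oneL1.
set defect := \sum_(p <- s) ract (lact p.1 (nu i) - ract (nu i) p.1) p.2.
(* The defect identity is solved for [mu], using that [one] acts trivially on [mu]. *)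
have mu_eq : mu = nu i + (- ract mu (mult (nu i) - one) + defect).
  rewrite /defect -(diagonal_defect smu Dmu (nuZ i)) raddfB /= (ract_oneL1 smu).
  by rewrite opprB subrKA addrC subrK.
rewrite [leLHS](congr1 (@normT R gT) mu_eq).
apply: le_trans (normTD _ _) _; rewrite lerD2l.
apply: le_trans (normTD _ _) _; rewrite normTN lerD //.
  by rewrite mulrC; apply: normT_ract.
apply: le_trans (normT_sum _ _) _; rewrite big_seq [leRHS]big_seq.
apply: ler_sum => p /sZ[p1 _]; rewrite pnorm_normT; first exact: normT_ract.
by apply: inZZB; [apply: inZZ_lact | apply: inZZ_ract].
Qed.

Lemma diagonal_approx mu :
  is_diagonal mu -> bdd_approx_diag (fun _ _ : unit => True) (fun=> mu).
Proof.
move=> [muZ [mu_bal mu1]]; split.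
  by split; [exists tt | split=> //; split=> // i; exists tt].
split=> //; split; first by exists (pnorm mu).
have norm1_0 : norm1 (0 : L1 R gT) = 0.
  by rewrite /norm1 big1 ?mulr0 // => s _; rewrite ffunE cmod0.
move=> a aZ; rewrite mu1 conv_oneL1 -(aZ (oneL1 R gT)) conv_oneL1 mu_bal // !subrr.
have normT_0 : pnorm (0 : Tens R gT) = 0.
  rewrite pnorm_normT; last by exists [::]; split; rewrite ?big_nil.
  by rewrite /normT big1 ?mulr0 // => s _; rewrite ffunE cmod0.
by rewrite norm1_0 normT_0; split; [|split] => e e_gt0; exists tt.
Qed.

Lemma amZL1_diagonal mu : is_diagonal mu -> amZL1 R gT = normT mu.
Proof.
move=> Dmu; rewrite /amZL1; set S := (X in inf X).
have Smu : S (normT mu).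
  exists unit, (fun _ _ => True), (fun=> mu); split; first exact: diagonal_approx.
  rewrite -pnorm_normT; last by case: Dmu.
  (* A constant net has a singleton range, so its supremum is the norm itself. *)
  rewrite (_ : range _ = [set pnorm mu]%classic) ?sup1 //.
  by apply/seteqP; split=> [_ [_ _ <-] //| _ ->]; exists tt.
have Sle : (lbound S (normT mu))%classic.
  move=> M [I [le [nu [nu_approx ->]]]]; apply: (diagonal_le_approx Dmu nu_approx).
  (* The bound [K] ensures that [sup] is a genuine upper bound of the norms. *)
  have [_ [_ [[K nuK] _]]] := nu_approx.
  by move=> i; apply: ub_le_sup; [exists K => _ [j _ <-] | exists i].
apply/eqP; rewrite eq_le ge_inf //=; last by exists (normT mu).
by apply: lb_le_inf => //; exists (normT mu).
Qed.

End AmenabilityConstant.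

(** * Schur's lemma and orthogonality relations *)

Section Schur.
Variables (R : realType) (gT : finGroupType) (n : nat).
Local Notation C := R[i].
Variable rG : mx_representation C [set: gT]%G n.

Let rGM x y : rG (x * y)%g = rG x *m rG y.
Proof. by rewrite repr_mxM ?inE. Qed.

(* [M], the sum of [rG g *m (rG g)^*], is positive definite and
   [rG x *m M *m (rG x)^* = M], so that [(rG x)^*] is conjugate to [rG x^-1]. *)
Lemma mxtrace_conj x : conjc (\tr (rG x)) = \tr (rG x^-1%g).
Proof.
pose adj m (A : 'M[C]_(m, n)) := (map_mx conjc A)^T.
have adjM m (A : 'M[C]_(m, n)) B : adj m (A *m B) = adj n B *m adj m A.
  by rewrite /adj map_mxM trmx_mul.
pose M := \sum_g rG g *m adj n (rG g).
have invM : rG x *m M *m adj n (rG x) = M.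
  rewrite mulmx_sumr mulmx_suml [RHS](reindex_inj (mulgI x)).
  by apply: eq_bigr => g _; rewrite rGM adjM !mulmxA.
have uM : M \in unitmx.
  rewrite -row_free_unit; apply: inj_row_free => v vM0.
  (* Pairing [v *m M = 0] with [v] gives a vanishing sum of squared norms of [v *m rG g]; the
     summand at 1 forces [v = 0]. *)
  have := congr1 (fun A => (A *m adj 1%N v) 0 0) vM0.
  rewrite mul0mx [RHS]mxE mulmx_sumr mulmx_suml summxE => /eqP.
  have termE g : (v *m (rG g *m adj n (rG g)) *m adj 1%N v) 0 0 =
      \sum_j (v *m rG g) 0 j * conjc ((v *m rG g) 0 j).
    by rewrite mulmxA -mulmxA -adjM mxE; apply: eq_bigr => j _; rewrite !mxE.
  under eq_bigr do rewrite termE.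
  have sum_ge0 g : 0 <= \sum_j (v *m rG g) 0 j * conjc ((v *m rG g) 0 j).
    by apply: sumr_ge0 => j _; apply: mulcJ_ge0.
  rewrite psumr_eq0 // => /allP/(_ 1%g); rewrite mem_index_enum => /(_ isT).
  rewrite repr_mx1 mulmx1 /= psumr_eq0 => [/allP v0|j _]; last exact: mulcJ_ge0.
  apply/rowP=> j; rewrite [RHS]mxE; have := v0 j; rewrite mem_index_enum => /(_ isT).
  by rewrite mulf_eq0 conjc_eq0 orbb => /eqP.
have -> : conjc (\tr (rG x)) = \tr (adj n (rG x)).
  by rewrite mxtrace_tr /mxtrace rmorph_sum; apply: eq_bigr => i _; rewrite mxE.
have -> : adj n (rG x) = invmx M *m (rG x^-1%g *m M).
  rewrite -{2}invM !mulmxA -(mulmxA (invmx M)) -rGM mulVg repr_mx1 mulmx1.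
  by rewrite mulVmx // mul1mx.
by rewrite mxtrace_mulC -mulmxA mulmxV // mulmx1.
Qed.

Hypothesis irrG : mx_irreducible rG.

(** [R[i]] is algebraically closed, so an irreducible representation is absolutely irreducible and
    its centraliser is scalar. *)
Lemma schur_scalar (A : 'M[C]_n) :
  (forall x, A *m rG x = rG x *m A) -> is_scalar_mx A.
Proof.
move=> cA; apply: (mx_abs_irr_cent_scalar (group_closure_closed_field irrG)).
by apply/centgmxP => x _.
Qed.

(** The sum over [g] commutes with the representation, hence is scalar, and its trace
    [#|gT| * \tr A] determines the scalar. *)
Lemma schur_average (A : 'M[C]_n) :
  n%:R *: (\sum_g rG g *m A *m rG g^-1%g) = (#|gT|%:R * \tr A)%:M.
Proof.
set B := \sum_g _.
have /schur_scalar/is_scalar_mxP[c Bc] x : B *m rG x = rG x *m B.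
  rewrite mulmx_sumr mulmx_suml (reindex_inj (mulgI x)).
  apply: eq_bigr => g _.
  by rewrite invMg !rGM -!mulmxA -rGM mulVg repr_mx1 mulmx1.
rewrite Bc scale_scalar_mx; congr _%:M.
have := congr1 mxtrace Bc; rewrite mxtrace_scalar mulr_natl => <-.
rewrite raddf_sum (eq_bigr (fun=> \tr A)) ?sumr_const ?mulr_natl // => g _.
by rewrite /= mxtrace_mulC mulmxA -rGM mulVg repr_mx1 mul1mx.
Qed.

(** Orthogonality of matrix entries is the [(i, k)] entry of [schur_average] at [delta_mx i j];
    summing over [i] produces the trace. *)
Lemma mxtrace_sum_repr :
  n%:R *: (\sum_g \tr (rG g) *: rG g^-1%g) = (#|gT|%:R : C)%:M.
Proof.
apply/matrixP=> j k.
have trD i : \tr (delta_mx i j : 'M[C]_n) = (i == j)%:R.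
  rewrite /mxtrace (bigD1 i) //= mxE eqxx big1 ?addr0 // => i' /negPf neq_i'.
  by rewrite mxE neq_i'.
have entry i : n%:R * \sum_g rG g i i * rG g^-1%g j k =
    #|gT|%:R * (i == j)%:R *+ (i == k).
  have /matrixP/(_ i k) := schur_average (delta_mx i j).
  rewrite !mxE summxE trD => <-; congr (_ * _).
  (* Written as column times row, [delta_mx i j] selects column [i] of [rG g] and row [j] of
     [rG g^-1]. *)
  apply: eq_bigr => g _; rewrite -(mul_delta_mx (0 : 'I_1)) mulmxA -colE -mulmxA -rowE.
  by rewrite mxE big_ord1 !mxE.
rewrite !mxE summxE; under eq_bigr do rewrite mxE mulr_suml.
rewrite exchange_big mulr_sumr (eq_bigr _ (fun i _ => entry i)).
rewrite (bigD1 j) //= eqxx mulr1 big1 ?addr0 // => i /negPf ->.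
by rewrite mulr0 mul0rn.
Qed.

Lemma mxtrace_conv s :
  n%:R * \sum_t \tr (rG t) * \tr (rG (t^-1 * s)%g) = #|gT|%:R * \tr (rG s).
Proof.
rewrite -mxtraceZ -mul_scalar_mx -mxtrace_sum_repr -scalemxAl mxtraceZ.
congr (_ * _); rewrite mulmx_suml raddf_sum; apply: eq_bigr => t _.
by rewrite /= -scalemxAl mxtraceZ rGM.
Qed.

(** A class function [a] makes the sum of [a t *: rG t^-1] commute with the representation, so it is
    a scalar [w]; multiply by [rG s] and take traces. *)
Lemma class_fun_eigen (a : gT -> C) : (forall x y, a (x ^ y)%g = a x) ->
  exists w, forall s, \sum_t a t * \tr (rG (t^-1 * s)%g) = w * \tr (rG s).
Proof.
move=> aJ; pose A := \sum_t a t *: rG t^-1%g.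
have /schur_scalar/is_scalar_mxP[w Aw] x : A *m rG x = rG x *m A.
  rewrite mulmx_sumr mulmx_suml [RHS](reindex_inj (conjg_inj x)).
  apply: eq_bigr => t _.
  by rewrite aJ -scalemxAl -scalemxAr -!rGM -conjVg -conjgC.
exists w => s; rewrite -mxtraceZ -mul_scalar_mx -Aw mulmx_suml raddf_sum.
by apply: eq_bigr => t _; rewrite /= -scalemxAl mxtraceZ rGM.
Qed.

End Schur.

(** * The diagonal built from characters and its norm *)

Section CharacterDiagonal.
Variables (R : realType) (gT : finGroupType) (sG : irrType R[i] [set: gT]%G).
Local Notation C := R[i].
Local Notation L1 := (L1 R gT).
Implicit Type p : sG.

Lemma chi_valJ p x y : chi_val p (x ^ y)%g = chi_val p x.
Proof.
rewrite /chi_val conjgE !repr_mxM ?inE // mxtrace_mulC -mulmxA -repr_mxM ?inE //.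
by rewrite mulgV repr_mx1 mulmx1.
Qed.

(** The normalised measure absorbs the factor [1/|G|] usual in central idempotents of the group
    algebra. *)
Definition chi_idem p : L1 := [ffun s => (irr_degree p)%:R * chi_val p s].

Lemma chi_idem_central p : inZL1 (chi_idem p).
Proof. by apply/inZL1P => x y; rewrite !ffunE chi_valJ. Qed.

Lemma conv_chi_idem p : conv (chi_idem p) (chi_idem p) = chi_idem p.
Proof.
apply/ffunP=> s; rewrite !ffunE.
under eq_bigr do rewrite !ffunE mulrACA -mulrA.
rewrite -mulr_sumr -mulr_sumr mxtrace_conv; last exact: socle_irr.
by rewrite mulrCA /ordG mulKf // ordG_neq0.
Qed.

(** Both sides are the character of the regular representation, which contains each irreducible as
    often as its degree. *)
Lemma sum_chi_idem : \sum_(p : sG) chi_idem p = oneL1 R gT.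
Proof.
have charG : ([pchar C]^').-group%g [set: gT]%G.
  by apply/pgroupP=> p _ _; rewrite inE /= pchar_num.
apply/ffunP=> s; rewrite sum_ffunE ffunE.
have := mxtrace_regular_pchar sG charG
  (group_closure_closed_field (G := _)) (finset.in_setT s).
rewrite (eq_bigr (fun p => chi_idem p s)) => [<-|p _]; last first.
  by rewrite ffunE mulr_natl.
case: eqVneq => [->|nt_s]; first by rewrite repr_mx1 mxtrace1 /gcard finset.cardsT.
(* Translation by [s] different from 1 fixes no group element, so the diagonal entries vanish. *)
rewrite [\tr _]big1 // => i _; rewrite 2!mxE /=.
rewrite -(inj_eq enum_val_inj) gring_indexK ?inE //.
by rewrite eq_mulVg1 mulKg (negbTE nt_s).
Qed.

Definition chi_diag : Tens R gT := \sum_(p : sG) tens (chi_idem p) (chi_idem p).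

Lemma chi_diag_is_diagonal : is_diagonal chi_diag.
Proof.
split; last split.
- exists [seq (chi_idem p, chi_idem p) | p <- index_enum sG].
  split; last by rewrite big_map.
  by move=> _ /mapP[p _ ->]; split; apply: chi_idem_central.
- move=> a aZ; rewrite -/(ract_by _ _) !raddf_sum; apply: eq_bigr => p _.
  rewrite /= /ract_by lact_tens ract_tens -(aZ (chi_idem p)).
  (* Convolution by [a] scales [chi_idem p] by a constant, which may be moved from one leg to the
     other. *)
  have [w aw] := class_fun_eigen (socle_irr p) (proj1 (inZL1P _) aZ).
  have convE s : conv a (chi_idem p) s = (ordG R gT)^-1 * w * chi_idem p s.
    rewrite !ffunE -mulrA; congr (_ * _); rewrite mulrCA -aw mulr_sumr.
    by apply: eq_bigr => t _; rewrite ffunE mulrCA.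
  by apply/ffunP=> q; rewrite !(ffunE _ q) !convE mulrCA mulrA.
rewrite raddf_sum -sum_chi_idem; apply: eq_bigr => p _.
by rewrite /= mult_tens conv_chi_idem.
Qed.

Lemma normT_chi_diag :
  normT chi_diag =
    (#|gT|%:R ^+ 2)^-1 *
    \sum_(Cl in classes [set: gT]) \sum_(Cl' in classes [set: gT])
      cmod (\sum_(p : sG) (irr_degree p)%:R ^+ 2
              * conjc (chi_val p (repr Cl)) * chi_val p (repr Cl'))
      * #|Cl|%:R * #|Cl'|%:R.
Proof.
pose F s t : R := cmod (\sum_(p : sG) (irr_degree p)%:R ^+ 2
  * conjc (chi_val p s) * chi_val p t).
have FJ s t x y : F (s ^ x)%g (t ^ y)%g = F s t.
  by congr cmod; apply: eq_bigr => p _; rewrite !chi_valJ.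
have FJl t : {in [set: gT]%G &, forall s x, F (s ^ x)%g t = F s t}.
  by move=> s x _ _; rewrite -[in LHS](conjg1 t) FJ.
have FJr s : {in [set: gT]%G &, forall t y, F s (t ^ y)%g = F s t}.
  by move=> t y _ _; rewrite -[in LHS](conjg1 s) FJ.
(* Inverting the first variable leaves the sum unchanged and lets [mxtrace_conj] introduce the
   conjugate. *)
congr (_ * _); rewrite sum_pair (reindex_inj invg_inj) /=.
transitivity (\sum_(s in [set: gT]%G) \sum_(t in [set: gT]%G) F s t).
  apply: eq_big => [s|s _]; first by rewrite inE.
  apply: eq_big => [t|t _]; first by rewrite inE.
  congr cmod; rewrite sum_ffunE; apply: eq_bigr => p _.
  by rewrite !ffunE /= /chi_val mxtrace_conj expr2 mulrACA mulrA.
(* The modulus [F] is a class function of each variable, so both sums are grouped by classes, one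
   variable at a time. *)
rewrite (eq_bigr _ (fun s _ => sum_by_classes (FJr s))).
rewrite exchange_big.
under eq_bigr do
  rewrite -mulr_sumr (sum_by_classes (FJl _)) mulr_sumr.
rewrite exchange_big; apply: eq_bigr => Cl _; apply: eq_bigr => Cl' _ /=.
by rewrite -/(F _ _) mulrC (mulrC #|Cl|%:R).
Qed.

End CharacterDiagonal.

Theorem theorem1p8 (R : realType) (gT : finGroupType)
    (sG : irrType R[i] [set: gT]%G) :
  (exists! mu : Tens R gT, is_diagonal mu) /\
  amZL1 R gT =
    (#|gT|%:R ^+ 2)^-1 *
    \sum_(Cl in classes [set: gT]) \sum_(Cl' in classes [set: gT])
      cmod (\sum_(p : sG) (mxrepresentation.irr_degree p)%:R ^+ 2
              * conjc (chi_val p (repr Cl)) * chi_val p (repr Cl'))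
      * #|Cl|%:R * #|Cl'|%:R.
Proof.
have Dchi := chi_diag_is_diagonal sG; split.
  by exists (chi_diag sG); split=> // nu; apply: diagonal_unique.
by rewrite (amZL1_diagonal Dchi) normT_chi_diag.
Qed.
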